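(* Let $p\ge 2$ be a prime and let $1\le m\le k$ be integers. If $f:\mathbb{Z}_p\to\mathbb{Z}_p$ is a $(p^{-k},p^{m})$ locally scaling map, then $f$ is shadowing.
   Context: $\mathbb{Z}_p$ is the ring of $p$-adic integers with the $p$-adic norm $\|\cdot\|_p$ (normalized so that $\|p\|_p=p^{-1}$) and metric $d(x,y)=\|x-y\|_p$. A map $f:\mathbb{Z}_p\to\mathbb{Z}_p$ is $(p^{-k},p^m)$ locally scaling if for all $x,y\in\mathbb{Z}_p$ with $\|x-y\|_p\le p^{-k}$ one has $\|f(x)-f(y)\|_p=p^m\|x-y\|_p$. For a continuous map $f:X\to X$ of a metric space $(X,d)$ and $\delta>0$, a $\delta$-pseudotrajectory is a sequence $(x_n)_{n\in\mathbb{N}}$ in $X$ with $d(f(x_n),x_{n+1})\le\delta$ for all $n\in\mathbb{N}$ ($\mathbb{N}$ includes $0$). The map $f$ is shadowing (has the shadowing property) if for every $\varepsilon>0$ there is $\delta>0$ such that for every $\delta$-pseudotrajectory $(x_n)_{n\in\mathbb{N}}$ there is $x\in X$ with $d(x_n,f^n(x))\le\varepsilon$ for all $n\in\mathbb{N}$. If $f$ is a homeomorphism, ''shadowing'' means the same property with $\mathbb{N}$ replaced by $\mathbb{Z}$. *)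

(* Defs.v *)
From HB Require Import structures.
From mathcomp Require Import all_boot all_order all_algebra.
From mathcomp Require Import boolp classical_sets reals topology.

Set Implicit Arguments.
Unset Strict Implicit.
Unset Printing Implicit Defensive.

Import Order.TTheory GRing.Theory Num.Theory.

Local Open Scope classical_set_scope.
Local Open Scope ring_scope.

(* The p-adic integers as the inverse limit of the rings Z/p^(n+1), n : nat.
   The moduli start at p^1 because 'Z_1 is not the zero ring; the missing
   factor Z/p^0 carries no information.  For x : 'Z_(p ^ n.+2), the cast
   (x : nat)%:R : 'Z_(p ^ n.+1) is the reduction map.  The proof of primality
   is a parameter of the type so that the structures below are canonical. *)
Record padic_int (p : nat) (p_pr : prime p) := PadicInt {
  residue : forall n, 'Z_(p ^ n.+1);
  residue_coherent : forall n, (residue n.+1 : nat)%:R = residue n }.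

Arguments residue {p p_pr} _ _ : simpl never.

Section reduction.
Variables d e : nat.
Hypotheses (d_gt1 : (1 < d)%N) (e_gt1 : (1 < e)%N) (dvd_de : (d %| e)%N).

Lemma natr_Zp_mod n : (n %% (Zp_trunc e).+2)%:R = n%:R :> 'Z_d.
Proof.
rewrite -[LHS](Zp_nat_mod d_gt1) (_ : (Zp_trunc e).+2 = e) ?Zp_cast//.
by rewrite modn_dvdm// Zp_nat_mod.
Qed.

Lemma natr_ZpD (x y : 'Z_e) :
  ((x + y)%R : nat)%:R = (x : nat)%:R + (y : nat)%:R :> 'Z_d.
Proof. by rewrite natr_Zp_mod natrD. Qed.

Lemma natr_ZpM (x y : 'Z_e) :
  ((x * y)%R : nat)%:R = (x : nat)%:R * (y : nat)%:R :> 'Z_d.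
Proof. by rewrite natr_Zp_mod natrM. Qed.

Lemma natr_ZpN (x : 'Z_e) : ((- x)%R : nat)%:R = - (x : nat)%:R :> 'Z_d.
Proof. by apply/eqP; rewrite -addr_eq0 -natr_ZpD addNr. Qed.

Lemma natr_Zp1 : ((1%R : 'Z_e) : nat)%:R = 1 :> 'Z_d.
Proof. by rewrite -(natr_Zp_mod 1). Qed.

End reduction.

Section padic_ring.
Variables (p : nat) (p_pr : prime p).
Local Notation Zp := (padic_int p_pr).
Implicit Types x y z : Zp.

Let pX_gt1 n : (1 < p ^ n.+1)%N.
Proof. by rewrite -(expn0 p) ltn_exp2l// prime_gt1. Qed.

Let pX_dvd n : (p ^ n.+1 %| p ^ n.+2)%N.
Proof. by rewrite dvdn_exp2l. Qed.

Lemma padic_int_eq x y : (forall n, residue x n = residue y n) -> x = y.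
Proof.
case: x y => [u uP] [v vP] /= uv.
have {}uv : u = v by apply: functional_extensionality_dep.
by case: v / uv vP => vP; congr PadicInt; exact: Prop_irrelevance.
Qed.

HB.instance Definition _ := gen_eqMixin Zp.
HB.instance Definition _ := gen_choiceMixin Zp.

Definition padic0 : Zp :=
  @PadicInt p p_pr (fun=> 0) (fun=> erefl).

Definition padic1 : Zp :=
  @PadicInt p p_pr (fun=> 1)
    (fun n => natr_Zp1 (pX_gt1 n) (pX_gt1 n.+1) (pX_dvd n)).

Definition padic_opp x : Zp.
Proof.
refine (@PadicInt p p_pr (fun n => - residue x n) _).
by move=> n; rewrite natr_ZpN// residue_coherent.
Defined.

Definition padic_add x y : Zp.
Proof.
refine (@PadicInt p p_pr (fun n => residue x n + residue y n) _).
by move=> n; rewrite natr_ZpD// !residue_coherent.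
Defined.

Definition padic_mul x y : Zp.
Proof.
refine (@PadicInt p p_pr (fun n => residue x n * residue y n) _).
by move=> n; rewrite natr_ZpM// !residue_coherent.
Defined.

Let addA : associative padic_add.
Proof. by move=> x y z; apply: padic_int_eq => n; exact: addrA. Qed.
Let addC : commutative padic_add.
Proof. by move=> x y; apply: padic_int_eq => n; exact: addrC. Qed.
Let add0 : left_id padic0 padic_add.
Proof. by move=> x; apply: padic_int_eq => n; exact: add0r. Qed.
Let addN : left_inverse padic0 padic_opp padic_add.
Proof. by move=> x; apply: padic_int_eq => n; exact: addNr. Qed.

HB.instance Definition _ := GRing.isZmodule.Build Zp addA addC add0 addN.

Let mulA : associative padic_mul.
Proof. by move=> x y z; apply: padic_int_eq => n; exact: mulrA. Qed.
Let mulC : commutative padic_mul.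
Proof. by move=> x y; apply: padic_int_eq => n; exact: mulrC. Qed.
Let mul1 : left_id padic1 padic_mul.
Proof. by move=> x; apply: padic_int_eq => n; exact: mul1r. Qed.
Let mulDl : left_distributive padic_mul padic_add.
Proof. by move=> x y z; apply: padic_int_eq => n; exact: mulrDl. Qed.
Let one_neq0 : padic1 != padic0.
Proof.
apply/eqP => /(congr1 (fun x => residue x 0)) h.
by have /eqP : (1 : 'Z_(p ^ 1)) = 0 := h; rewrite oner_eq0.
Qed.

HB.instance Definition _ :=
  GRing.Zmodule_isComNzRing.Build Zp mulA mulC mul1 mulDl one_neq0.

Lemma residue0 n : residue (0 : Zp) n = 0. Proof. by []. Qed.
Lemma residueD x y n : residue (x + y) n = residue x n + residue y n.
Proof. by []. Qed.
Lemma residueN x n : residue (- x) n = - residue x n. Proof. by []. Qed.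
Lemma residueM x y n : residue (x * y) n = residue x n * residue y n.
Proof. by []. Qed.
Lemma residue_nat k n : residue (k%:R : Zp) n = k%:R.
Proof. by elim: k => [//|k IH]; rewrite !mulrS residueD IH. Qed.

Lemma residue_eq0_le x n m : (n <= m)%N -> residue x m = 0 -> residue x n = 0.
Proof.
move=> /subnKC <-; elim: (m - n)%N => [|k IH]; first by rewrite addn0.
by rewrite addnS => xk; apply: IH; rewrite -residue_coherent xk.
Qed.

Definition padic_entourage : set_system (Zp * Zp) :=
  filter_from [set: nat] (fun n => [set xy | residue (xy.1 - xy.2) n = 0]).

Let ent_filter : Filter padic_entourage.
Proof.
apply: filter_from_filter; first by exists 0.
move=> i j _ _; exists (maxn i j) => // xy /= h.
by split; apply: residue_eq0_le h; rewrite ?leq_maxl ?leq_maxr.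
Qed.

Let ent_diag A : padic_entourage A -> (diagonal `<=` A)%classic.
Proof.
move=> [n _ nA] xy; rewrite /diagonal/= => xyE.
by apply: nA => /=; rewrite xyE subrr.
Qed.

Let ent_inv A : padic_entourage A -> padic_entourage (A^-1)%relation.
Proof.
move=> [n _ nA]; exists n => // xy /= h.
by apply: nA => /=; rewrite -opprB residueN h oppr0.
Qed.

Let ent_split A : padic_entourage A ->
  exists2 B, padic_entourage B & ((B \; B)%relation `<=` A)%classic.
Proof.
move=> [n _ nA]; exists [set xy | residue (xy.1 - xy.2) n = 0].
  by exists n.
move=> [x z] [y /= xy yz]; apply: nA => /=.
by rewrite -(subrKA y) residueD xy yz addr0.
Qed.

HB.instance Definition _ :=
  isUniform.Build Zp ent_filter ent_diag ent_inv ent_split.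

End padic_ring.

Section padic_metric.
Variables (R : realType) (p : nat) (p_pr : prime p).
Local Notation Zp := (padic_int p_pr).
Implicit Types x y z : Zp.

(* As residue x n is the class of x modulo p^(n+1), the least n such that
   residue x n != 0 is the p-adic valuation of x. *)
Definition padic_norm x : R :=
  if pselect (exists n, residue x n != 0) is left x_neq0
  then p%:R ^- ex_minn x_neq0 else 0.

Let p_gt0 : 0 < p%:R :> R. Proof. by rewrite ltr0n prime_gt0. Qed.
Let p_gt1 : 1 < p%:R :> R. Proof. by rewrite ltr1n prime_gt1. Qed.

Lemma padic_norm_ge0 x : 0 <= padic_norm x.
Proof.
by rewrite /padic_norm; case: pselect => // h; rewrite invr_ge0 exprn_ge0// ltW.
Qed.

Lemma padic_norm_le x n : (padic_norm x <= p%:R ^- n.+1) = (residue x n == 0).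
Proof.
rewrite /padic_norm; case: pselect => [h|h].
  case: ex_minnP => v xv vmin.
  rewrite lef_pV2 ?posrE ?exprn_gt0// ler_eXn2l//.
  apply/idP/eqP => [nv|xn].
    by apply/eqP/negPn/negP => /vmin; rewrite leqNgt nv.
  rewrite ltnNge; apply/negP => vn.
  by move: xv; rewrite (residue_eq0_le vn xn) eqxx.
rewrite invr_ge0 exprn_ge0 ?(ltW p_gt0)//; apply/esym/negPn/negP => xn.
by apply: h; exists n.
Qed.

Lemma padic_norm0_eq0 x : padic_norm x = 0 -> x = 0.
Proof.
move=> x0; apply: padic_int_eq => n; apply/eqP.
by rewrite residue0 -padic_norm_le x0 invr_ge0 exprn_ge0// ltW.
Qed.

Lemma padic_norm0 : padic_norm 0 = 0.
Proof.
rewrite /padic_norm; case: pselect => // h; exfalso.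
by case: h => n; rewrite residue0 eqxx.
Qed.

Lemma padic_normN x : padic_norm (- x) = padic_norm x.
Proof.
rewrite /padic_norm; case: pselect => [h|h]; case: pselect => [h'|h'] //.
- congr (_ ^- _); apply: eq_ex_minn => n; by rewrite residueN oppr_eq0.
- by exfalso; apply: h'; case: h => n; rewrite residueN oppr_eq0; exists n.
- by exfalso; apply: h; case: h' => n xn; exists n; rewrite residueN oppr_eq0.
Qed.

Lemma padic_norm_max x y :
  padic_norm (x + y) <= Num.max (padic_norm x) (padic_norm y).
Proof.
rewrite {1}/padic_norm; case: pselect => [h|_]; last first.
  by rewrite le_max padic_norm_ge0.
case: ex_minnP => v xyv _; rewrite leNgt gt_max; apply/negP => /andP[].
have key z : padic_norm z < p%:R ^- v -> residue z v = 0.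
  rewrite /padic_norm; case: pselect => [h'|h' _]; last first.
    by apply/eqP/negPn/negP => zv; apply: h'; exists v.
  case: ex_minnP => w zw wmin.
  rewrite ltf_pV2 ?posrE ?exprn_gt0// ltr_eXn2l// => vw.
  by apply/eqP/negPn/negP => /wmin; rewrite leqNgt vw.
by move=> /key xv /key yv; move: xyv; rewrite residueD xv yv addr0 eqxx.
Qed.

Lemma padic_norm_p : padic_norm p%:R = p%:R^-1.
Proof.
have p0 : residue (p%:R : Zp) 0 = 0.
  by apply: ord_inj; rewrite residue_nat val_Zp_nat ?expn1 ?prime_gt1//= modnn.
have p1 : residue (p%:R : Zp) 1 != 0.
  have p2_gtp : (p < p ^ 2)%N by rewrite -{1}(expn1 p) ltn_exp2l ?prime_gt1.
  apply/eqP => /(congr1 (@nat_of_ord _)); rewrite residue_nat val_Zp_nat.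
    by rewrite modn_small// => pE; move: p_pr; rewrite pE.
  exact: ltn_trans (prime_gt1 p_pr) p2_gtp.
rewrite /padic_norm; case: pselect => [h|h].
  case: ex_minnP => -[|[|v]] pv vmin; first by rewrite p0 eqxx in pv.
    by rewrite expr1.
  by move: (vmin _ p1).
by exfalso; apply: h; exists 1%N.
Qed.

Definition padic_dist x y : R := padic_norm (x - y).

Let pball x (e : R) : set Zp := [set y | padic_dist x y < e].

Lemma padic_distxx x : padic_dist x x = 0.
Proof. by rewrite /padic_dist subrr padic_norm0. Qed.

Lemma padic_distC x y : padic_dist x y = padic_dist y x.
Proof. by rewrite /padic_dist -opprB padic_normN. Qed.

Lemma padic_dist_max y x z :
  padic_dist x z <= Num.max (padic_dist x y) (padic_dist y z).
Proof. by rewrite /padic_dist -(subrKA y) padic_norm_max. Qed.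

Let pball_center x (e : R) : 0 < e -> pball x e x.
Proof. by move=> e0; rewrite /pball/= padic_distxx. Qed.

Let pball_sym x y (e : R) : pball x e y -> pball y e x.
Proof. by rewrite /pball/= padic_distC. Qed.

Let pball_triangle x y z (e1 e2 : R) :
  pball x e1 y -> pball y e2 z -> pball x (e1 + e2) z.
Proof.
rewrite /pball/= => xy yz; apply: (le_lt_trans (padic_dist_max y _ _)).
have e1_gt0 : 0 < e1 by apply: le_lt_trans xy; exact: padic_norm_ge0.
have e2_gt0 : 0 < e2 by apply: le_lt_trans yz; exact: padic_norm_ge0.
by rewrite gt_max; apply/andP; split;
  [apply: (lt_trans xy); rewrite ltrDl | apply: (lt_trans yz); rewrite ltrDr].
Qed.

Let pball_entourage : entourage = entourage_ pball.
Proof.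
apply/seteqP; split => A.
  move=> [n _ nA]; exists (p%:R ^- n.+1); first by rewrite /= invr_gt0 exprn_gt0.
  move=> xy /= /ltW; rewrite padic_norm_le => /eqP; exact: nA.
move=> [e /= e0 eA].
have [n ne] : exists n, p%:R ^- n.+1 < e.
  exists (Num.truncn e^-1).
  rewrite -[ltRHS]invrK ltf_pV2 ?posrE ?exprn_gt0 ?invr_gt0//.
  apply: (lt_trans (truncnS_gt _)).
  by rewrite -natrX ltr_nat ltn_expl// prime_gt1.
exists n => // xy /= /eqP; rewrite -padic_norm_le => xyn.
by apply: eA => /=; exact: le_lt_trans ne.
Qed.

HB.instance Definition _ := @Uniform_isPseudoMetric.Build R Zp
  pball pball_center pball_sym pball_triangle pball_entourage.

Let padic_dist_ge0 x y : 0 <= padic_dist x y.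
Proof. exact: padic_norm_ge0. Qed.

Let padic_dist_eq0 x y : padic_dist x y = 0 -> x = y.
Proof. by move=> /padic_norm0_eq0 /eqP; rewrite subr_eq0 => /eqP. Qed.

HB.instance Definition _ := @PseudoMetric_isMetric.Build R Zp
  padic_dist padic_dist_ge0 padic_dist_eq0 (fun _ _ => erefl).

Lemma padic_mdistE x y : mdist x y = padic_norm (x - y).
Proof. by []. Qed.

End padic_metric.

Definition locally_scaling (R : realType) (p : nat) (p_pr : prime p)
    (k m : nat) (f : padic_int p_pr -> padic_int p_pr) : Prop :=
  forall x y, padic_norm R (x - y) <= p%:R ^- k ->
    padic_norm R (f x - f y) = p%:R ^+ m * padic_norm R (x - y).

Section shadowing.
Variables (R : realType) (X : metricType R).
Implicit Types (f g : X -> X) (delta eps : R).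

Definition pseudotrajectory f delta (x : nat -> X) : Prop :=
  forall n, mdist (f (x n)) (x n.+1) <= delta.

Definition pseudotrajectoryZ f delta (x : int -> X) : Prop :=
  forall n, mdist (f (x n)) (x (n + 1)) <= delta.

Definition inverse_homeo f g : Prop :=
  [/\ continuous f, continuous g, cancel f g & cancel g f].

Definition homeomorphism f : Prop := exists g, inverse_homeo f g.

(* The integer iterate f^n, where g is the inverse of f. *)
Definition iterz f g (n : int) : X -> X :=
  match n with Posz k => iter k f | Negz k => iter k.+1 g end.

Definition shadowingN f : Prop :=
  forall eps, 0 < eps -> exists2 delta, 0 < delta &
    forall x : nat -> X, pseudotrajectory f delta x ->
      exists y, forall n, mdist (x n) (iter n f y) <= eps.

Definition shadowingZ f g : Prop :=
  forall eps, 0 < eps -> exists2 delta, 0 < delta &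
    forall x : int -> X, pseudotrajectoryZ f delta x ->
      exists y, forall n, mdist (x n) (iterz f g n y) <= eps.

(* Two-sided shadowing if f is a homeomorphism, one-sided otherwise. *)
Definition shadowing f : Prop :=
  (~ homeomorphism f -> shadowingN f) /\
  (forall g, inverse_homeo f g -> shadowingZ f g).

End shadowing.

Arguments locally_scaling R {p p_pr} k m f.
Arguments shadowing R {X} f.

(* Main.v *)
(** A locally scaling map sends the ball of radius p^-k around a bijectively
    onto the ball of radius p^(m-k) around f a, both being counted at every
    finite level.  The p^k balls of radius p^-k have as images balls of radius
    p^(m-k), of which there are fewer, so f is not injective and the two-sided
    clause is vacuous.  For the one-sided clause, f expands the ball of radius
    p^-N around x_i onto a set containing the ball of the same radius around
    x_(i+1); pulling x_(i+l) back along the pseudotrajectory by these l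
    contracting inverse branches and letting l tend to infinity gives the
    shadowing point. *)
Require Import Defs.
From mathcomp Require Import all_boot all_order all_algebra.
From mathcomp Require Import boolp classical_sets reals topology.

Set Implicit Arguments.
Unset Strict Implicit.
Unset Printing Implicit Defensive.

Import Order.TTheory GRing.Theory Num.Theory.
Local Open Scope ring_scope.

Lemma val_residue_nat (p : nat) (p_pr : prime p) (a n : nat) :
  residue (a%:R : padic_int p_pr) n = (a %% p ^ n.+1)%N :> nat.
Proof.
by rewrite residue_nat val_Zp_nat// -(expn0 p) ltn_exp2l// prime_gt1.
Qed.

Lemma residue_mod (p : nat) (p_pr : prime p) (x : padic_int p_pr) n :
  (residue x n.+1 %% p ^ n.+1)%N = residue x n.
Proof.
by rewrite -[in RHS]residue_coherent val_Zp_nat// -(expn0 p) ltn_exp2l// prime_gt1.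
Qed.

(* The class of x modulo p^n; unlike [residue], this includes p^0. *)
Definition padic_mod (p : nat) (p_pr : prime p) (n : nat)
  (x : padic_int p_pr) : nat := (residue x n %% p ^ n)%N.

Lemma padic_modS (p : nat) (p_pr : prime p) (x : padic_int p_pr) n :
  padic_mod n.+1 x = residue x n.
Proof. exact: residue_mod. Qed.

Lemma padic_mod_lt (p : nat) (p_pr : prime p) (x : padic_int p_pr) n :
  (padic_mod n x < p ^ n)%N.
Proof. by rewrite ltn_mod expn_gt0 prime_gt0. Qed.

Lemma padic_mod_mod (p : nat) (p_pr : prime p) (x : padic_int p_pr) i n :
  (i <= n)%N -> (padic_mod n x %% p ^ i)%N = padic_mod i x.
Proof.
move=> /subnKC <-; elim: (n - i)%N => [|l IH].
  by rewrite addn0 modn_small ?padic_mod_lt.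
rewrite addnS padic_modS -IH [in RHS]/padic_mod modn_dvdm//.
by rewrite dvdn_exp2l// leq_addr.
Qed.

Lemma padic_mod_le (p : nat) (p_pr : prime p) (x y : padic_int p_pr) i n :
  (i <= n)%N -> padic_mod n x = padic_mod n y -> padic_mod i x = padic_mod i y.
Proof. by move=> lein xy; rewrite -!(padic_mod_mod _ lein) xy. Qed.

Lemma padic_mod_eq (p : nat) (p_pr : prime p) (x y : padic_int p_pr) :
  (forall n, padic_mod n x = padic_mod n y) -> x = y.
Proof.
move=> xy; apply: padic_int_eq => n; apply: ord_inj.
by rewrite -!padic_modS.
Qed.

Lemma padic_mod_nat (p : nat) (p_pr : prime p) (a n : nat) :
  padic_mod n (a%:R : padic_int p_pr) = (a %% p ^ n)%N.
Proof. by rewrite /padic_mod val_residue_nat modn_dvdm// dvdn_exp2l. Qed.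

Lemma padic_norm_sub_le (R : realType) (p : nat) (p_pr : prime p)
    (x y : padic_int p_pr) n :
  (padic_norm R (x - y) <= p%:R ^- n) = (padic_mod n x == padic_mod n y).
Proof.
case: n => [|n].
  rewrite /padic_mod expn0 !modn1 eqxx expr0 invr1 /padic_norm.
  case: pselect => h; last by rewrite ler01.
  rewrite invf_le1 ?exprn_gt0 ?ltr0n ?prime_gt0//.
  by rewrite exprn_ege1// ler1n prime_gt0.
by rewrite padic_norm_le residueD residueN subr_eq0 !padic_modS.
Qed.

(** Completeness of the p-adic integers: from index [n.+1] on, the terms agree modulo p^(a+n+1), so
    the diagonal residues of [u n.+1] at level [n] are coherent. *)
Lemma padic_mod_lim (p : nat) (p_pr : prime p) (a : nat)
    (u : nat -> padic_int p_pr) :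
  (forall n, padic_mod (a + n) (u n) = padic_mod (a + n) (u n.+1)) ->
  exists y : padic_int p_pr,
    forall n, padic_mod (a + n) y = padic_mod (a + n) (u n).
Proof.
move=> uP.
have u_stable n l : padic_mod (a + n) (u n) = padic_mod (a + n) (u (n + l)%N).
  elim: l => [|l ->]; first by rewrite addn0.
  by rewrite addnS; apply: padic_mod_le (uP _); rewrite addnA leq_addr.
have yP n : (residue (u n.+2) n.+1 : nat)%:R = residue (u n.+1) n.
  rewrite residue_coherent; apply: ord_inj; rewrite -!padic_modS.
  by apply/esym; apply: padic_mod_le (uP n.+1); rewrite leq_addl.
exists (PadicInt p_pr yP) => n; case E : (a + n)%N => [|l].
  by rewrite /padic_mod expn0 !modn1.
transitivity (padic_mod l.+1 (u l.+1)); first by rewrite !padic_modS.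
by rewrite -E (u_stable n a) addnC.
Qed.

Section locally_scaling.
Variables (R : realType) (p : nat) (p_pr : prime p) (k m : nat).
Variable f : padic_int p_pr -> padic_int p_pr.
Implicit Types a x y z w : padic_int p_pr.
Hypotheses (m_le_k : (m <= k)%N) (f_scaling : locally_scaling R k m f).

(** Since scaling is an equality of norms, congruences transfer both ways, losing [m] digits under
    [f] and gaining them back under its inverse branches. *)
Lemma scaling_mod n x y : (m <= n)%N -> padic_mod k x = padic_mod k y ->
  (padic_mod n x == padic_mod n y) =
  (padic_mod (n - m) (f x) == padic_mod (n - m) (f y)).
Proof.
move=> mn /eqP; rewrite -!(padic_norm_sub_le R) => /f_scaling ->.
rewrite mulrC -ler_pdivlMr ?exprn_gt0 ?ltr0n ?prime_gt0//.
by rewrite -invfM -exprD subnK.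
Qed.

(** The points a + i p^k with i < p^n are distinct modulo p^(k+n), so their images are distinct
    modulo p^(k-m+n). These images lie in one class modulo p^(k-m), which splits into exactly p^n
    finer classes, so every finer class is hit. *)
Lemma scaling_onto_mod n a y :
  padic_mod (k - m) (f a) = padic_mod (k - m) y ->
  exists2 z, padic_mod k a = padic_mod k z &
    padic_mod (k - m + n) (f z) = padic_mod (k - m + n) y.
Proof.
move=> ay; pose pt (i : 'I_(p ^ n)) : padic_int p_pr := a + (i * p ^ k)%:R.
have p_gt0 i : (0 < p ^ i)%N by rewrite expn_gt0 prime_gt0.
have ptE i : padic_mod k a = padic_mod k (pt i).
  apply/eqP; rewrite -(padic_norm_sub_le R) opprD addNKr padic_normN.
  by rewrite -[X in padic_norm _ X]subr0 padic_norm_sub_le (padic_mod_nat _ _ k)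
    modnMl (padic_mod_nat p_pr 0) mod0n.
have fptE i : padic_mod (k - m) (f (pt i)) = padic_mod (k - m) y.
  by rewrite -ay; apply/eqP; rewrite eq_sym -scaling_mod// (ptE i).
have quo_lt w : (padic_mod (k - m + n) w %/ p ^ (k - m) < p ^ n)%N.
  by rewrite ltn_divLR// -expnD addnC padic_mod_lt.
have modE w : padic_mod (k - m + n) w =
    (padic_mod (k - m + n) w %/ p ^ (k - m) * p ^ (k - m)
     + padic_mod (k - m) w)%N.
  by rewrite {1}(divn_eq (padic_mod _ w) (p ^ (k - m)))
    padic_mod_mod ?leq_addr.
(* The quotient numbers the finer classes inside the common class modulo p^(k-m). *)
pose quo i := Ordinal (quo_lt (f (pt i))).
have quo_inj : injective quo.
  move=> i j [ij].
  have /eqP : padic_mod (k - m + n) (f (pt i)) = padic_mod (k - m + n) (f (pt j)).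
    by rewrite modE [RHS]modE ij !fptE.
  rewrite addnBAC// -scaling_mod ?(leq_trans m_le_k) ?leq_addr//; last first.
    by rewrite -!ptE.
  rewrite -(padic_norm_sub_le R) opprD addrACA subrr add0r padic_norm_sub_le.
  rewrite !padic_mod_nat !modn_small; first last.
  - by rewrite expnD mulnC ltn_mul2l p_gt0/=.
  - by rewrite expnD mulnC ltn_mul2l p_gt0/=.
  by rewrite eqn_mul2r gtn_eqF//= => /eqP /ord_inj.
have /codomP[i iE] := inj_card_onto quo_inj (leqnn _) (Ordinal (quo_lt y)).
exists (pt i) => //.
by move: iE => [iE]; rewrite modE [RHS]modE iE fptE.
Qed.

(** The approximate preimages have images that agree to growing precision; by scaling they form a
    Cauchy sequence, whose limit is an exact preimage. *)
Lemma scaling_onto a y : padic_mod (k - m) (f a) = padic_mod (k - m) y ->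
  exists2 z, padic_mod k a = padic_mod k z & f z = y.
Proof.
move=> ay.
have zP n : exists z, padic_mod k a = padic_mod k z /\
    padic_mod (k - m + n) (f z) = padic_mod (k - m + n) y.
  by have [z] := scaling_onto_mod n ay; exists z.
have [u uP] := choice zP.
have mkn n : (m <= k + n)%N by rewrite (leq_trans m_le_k) ?leq_addr.
have [|z zu] := @padic_mod_lim p p_pr k u.
  move=> n; apply/eqP; rewrite scaling_mod//; last by rewrite -!(uP _).1.
  rewrite -addnBAC// (uP n).2 eq_sym.
  by rewrite (padic_mod_le _ (uP n.+1).2)// leq_add2l.
have za : padic_mod k a = padic_mod k z.
  by rewrite (uP 0).1 -[k]addn0 zu.
exists z => //; apply: padic_mod_eq => n.
apply: (@padic_mod_le _ _ _ _ n (k - m + n)); first exact: leq_addl.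
rewrite -(uP n).2 addnBAC//; apply/eqP; rewrite -scaling_mod//.
  by rewrite zu.
by rewrite -(uP n).1 za.
Qed.

(** If the balls around i and j have the same image ball, some z in the ball of i satisfies f z = f
    j. Injectivity would give z = j, hence i = j, so p^k balls would inject into p^(k-m) classes. *)
Lemma scaling_not_injective : (1 <= m)%N -> ~ injective f.
Proof.
move=> m_gt0 f_inj.
pose q (i : 'I_(p ^ k)) := Ordinal (padic_mod_lt (f (i : nat)%:R) (k - m)).
have [q_inj|] := pselect (injective q).
  have := leq_card q q_inj; rewrite !card_ord leq_exp2l ?prime_gt1//.
  by rewrite leqNgt ltn_subrL m_gt0 (leq_trans m_gt0).
apply=> i j [ij]; have [z iz /f_inj zj] := scaling_onto ij.
by apply: ord_inj; move: iz; rewrite zj !padic_mod_nat !modn_small.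
Qed.

Lemma scaling_branch N x y : (k <= N)%N ->
  padic_mod N (f x) = padic_mod N y ->
  exists z, padic_mod N x = padic_mod N z /\ f z = y.
Proof.
move=> kN xy.
have [|z xz zy] := @scaling_onto x y.
  by apply: padic_mod_le xy; rewrite (leq_trans (leq_subr _ _)).
exists z; split=> //; apply/eqP; rewrite scaling_mod ?(leq_trans m_le_k)// zy.
by apply/eqP; apply: padic_mod_le xy; rewrite leq_subr.
Qed.

Lemma scaling_shadow N (x : nat -> padic_int p_pr) :
  (1 <= m)%N -> (k <= N)%N ->
  (forall n, padic_mod N (f (x n)) = padic_mod N (x n.+1)) ->
  exists y, forall n, padic_mod N (x n) = padic_mod N (iter n f y).
Proof.
move=> m_gt0 kN xP.
have mN l : (m <= N + l)%N.
  by rewrite (leq_trans m_le_k) ?(leq_trans kN) ?leq_addr.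
(* Keeping the congruence as a premise makes the branch total, so that [choice] applies; outside the
   ball the value is a dummy. *)
have branch (iw : nat * padic_int p_pr) : exists z,
    padic_mod N (x iw.1.+1) = padic_mod N iw.2 ->
    padic_mod N (x iw.1) = padic_mod N z /\ f z = iw.2.
  case: iw => i w /=.
  have [xw|] := pselect (padic_mod N (x i.+1) = padic_mod N w).
    have [|z zP] := @scaling_branch N (x i) w kN; first by rewrite xP.
    by exists z.
  by move=> nxw; exists w.
have [g gP] := choice branch.
(* [h l i] is x_(i+l) pulled back to time i. *)
pose fix h (l i : nat) {struct l} := if l is l'.+1 then g (i, h l' i.+1) else x i.
have xh l i : padic_mod N (x i) = padic_mod N (h l i).
  by elim: l i => [//|l IH] i; have [] := gP (i, h l i.+1) (IH _).
have fh l i : f (h l.+1 i) = h l i.+1.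
  by have [] := gP (i, h l i.+1) (xh _ _).
(* Each pullback gains m digits; as m >= 1, at least one digit is gained. *)
have hh l i : padic_mod (N + l) (h l i) = padic_mod (N + l) (h l.+1 i).
  elim: l i => [|l IH] i; first by rewrite addn0 -!xh.
  apply/eqP; rewrite scaling_mod//; last first.
    by apply: (padic_mod_le kN); rewrite -!xh.
  rewrite !fh; apply/eqP; apply: padic_mod_le (IH i.+1).
  by rewrite leq_subLR addnS -addSn -add1n -addnA leq_add2r.
have [y yP] := choice (fun i => padic_mod_lim (fun l => hh l i)).
have yx i : padic_mod N (y i) = padic_mod N (x i).
  by have := yP i 0%N; rewrite addn0.
have fy i : f (y i) = y i.+1.
  apply: padic_mod_eq => n; set l := (m + n)%N.
  (* With l = m + n this level is N + n + 1, and it is at most N + l because m >= 1. *)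
  apply: (@padic_mod_le _ _ _ _ n (N + l.+1 - m)).
    by rewrite leq_subRL// addnS -addSn leq_addl.
  transitivity (padic_mod (N + l.+1 - m) (f (h l.+1 i))).
    apply/eqP; rewrite -scaling_mod ?yP//.
    by apply: (padic_mod_le kN); rewrite yx -xh.
  rewrite fh; apply/esym; apply: padic_mod_le (yP i.+1 l).
  by rewrite leq_subLR addnS -addSn -add1n -addnA leq_add2r.
exists (y 0%N) => n; rewrite -yx; congr padic_mod.
by elim: n => //= n <-.
Qed.

End locally_scaling.

Theorem theorem1 (R : realType) (p : nat) (p_pr : prime p) (k m : nat)
    (m_ge1 : (1 <= m)%N) (m_le_k : (m <= k)%N)
    (f : padic_int p_pr -> padic_int p_pr)
    (f_scaling : locally_scaling R k m f) :
  shadowing R f.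
Proof.
split=> [_ eps eps_gt0|g [_ _ fg _]]; last first.
  by have := scaling_not_injective m_le_k f_scaling m_ge1 (can_inj fg).
have p_gt0 n : 0 < p%:R ^+ n :> R by rewrite exprn_gt0// ltr0n prime_gt0.
(* The second term ensures 1/eps < N < p^N. *)
pose N := maxn k (Num.truncn eps^-1).+1.
have N_eps : p%:R ^- N <= eps.
  rewrite -[leRHS]invrK lef_pV2 ?posrE ?invr_gt0//.
  apply/ltW/(lt_le_trans (truncnS_gt _)).
  rewrite -natrX ler_nat (leq_trans (leq_maxr k _))// ltnW//.
  by rewrite ltn_expl// prime_gt1.
(* The same radius serves as [delta] and as shadowing precision, since errors do not accumulate in
   an ultrametric. *)
exists (p%:R ^- N); first by rewrite invr_gt0.
move=> x xP.
have [|y yP] := scaling_shadow m_le_k f_scaling m_ge1 (leq_maxl _ _ : (k <= N)%N)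
    (x := x).
  by move=> n; apply/eqP; rewrite -(padic_norm_sub_le R); exact: xP.
exists y => n; apply: le_trans N_eps.
by rewrite padic_mdistE padic_norm_sub_le yP.
Qed.
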